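(* Let $K\subseteq\mathbf{R}^n$ be a nonempty unbounded closed set and let $f=(f_1,\dots,f_q):\mathbf{R}^n\to\mathbf{R}^q$ be a vector polynomial with $\deg f_i=d_i\ge1$, $\mathbf d=(d_1,\dots,d_q)$. Let $\bar x\in K$ and $\lambda=(\lambda_1,\dots,\lambda_q)\in\mathbf{R}^q_+\setminus\{0\}$. If there exists a closed set $S\subseteq\mathbf{R}^n$ with $(K_{\bar x})_\infty\subseteq S_\infty\subseteq K_\infty$ such that one of the following conditions holds: (i) $SOL(S_\infty,\{\sum_{i=1}^q\lambda_i f_i\}^\infty_d)=\{0\}$; (ii) $SOL^{s}(S_\infty,f^\infty_{\mathbf d})=\{0\}$; (iii) $SOL^{w}(S_\infty,f^\infty_{\mathbf d})=\{0\}$, then $SOL^{s}(K,f)$ is nonempty. In addition, if condition (iii) holds with a set $S$ satisfying $K_\infty\cap\big(\bigcup_{i=1}^q\{x\in\mathbf{R}^n:(f_i)^\infty_{d_i}(x)\le0\}\big)\subseteq S_\infty\subseteq K_\infty$, then $SOL^{s}(K,f)$ is also bounded.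
   Context: $\mathbf{R}^q_+$ is the nonnegative orthant; $y\le z$ in $\mathbf{R}^q$ means $z-y\in\mathbf{R}^q_+$. $K_{\bar x}=\{x\in K: f(x)\le f(\bar x)\}$. The asymptotic cone of a nonempty set $S$ is $S_\infty=\{v:\exists\, t_k\to+\infty,\ x_k\in S \text{ with } x_k/t_k\to v\}$. For a polynomial $p$ of degree $d$, $p^\infty_d(x)=\lim_{t\to+\infty}p(tx)/t^d$, and $f^\infty_{\mathbf d}=((f_1)^\infty_{d_1},\dots,(f_q)^\infty_{d_q})$; in $\{\sum_i\lambda_i f_i\}^\infty_d$ the index is $d=\deg\sum_i\lambda_i f_i$. $SOL(A,p)$ is the set of global minimizers of the scalar function $p$ over $A$. $SOL^{s}(A,g)=\{x^*\in A: g(x)-g(x^* )\notin-\mathbf{R}^q_+\setminus\{0\}\ \forall x\in A\}$ (Pareto efficient solutions), $SOL^{w}(A,g)=\{x^*\in A: g(x)-g(x^* )\notin-\operatorname{int}\mathbf{R}^q_+\ \forall x\in A\}$ (weak Pareto efficient solutions). *)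

(* Defs.v *)
From HB Require Import structures.
From mathcomp Require Import all_boot all_order all_algebra.
From mathcomp Require Import all_classical all_reals all_analysis.
(* The notations of mpoly clash with those of MathComp-Analysis; the rest of
   the file, including its canonical instances, can be imported. *)
From mathcomp Require Import -(notations) mpoly.

Set Implicit Arguments.
Unset Strict Implicit.
Unset Printing Implicit Defensive.

Import Order.TTheory GRing.Theory Num.Theory.
Import numFieldNormedType.Exports.

Local Open Scope classical_set_scope.
Local Open Scope ring_scope.

Definition orthant (R : realType) (q : nat) : set 'rV[R]_q :=
  [set y | forall i, 0 <= y 0 i].

Definition vle (R : realType) (q : nat) (y z : 'rV[R]_q) : Prop :=
  orthant (z - y).

Definition peval (R : realType) (n : nat) (p : mpoly n R)
  (x : 'rV[R]_n) : R := meval (fun j => x 0 j) p.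

Definition vpeval (R : realType) (n q : nat) (f : 'I_q -> mpoly n R)
  (x : 'rV[R]_n) : 'rV[R]_q := \row_i peval (f i) x.

(* The library's [msize] is one more than the total degree, and [msize 0 = 0];
   the zero polynomial hence gets degree 0. *)
Definition pdeg (R : realType) (n : nat) (p : mpoly n R) : nat :=
  (msize p).-1.

(* To be used with [d = pdeg p]: [lim] is a junk value if the limit fails to
   exist, as it may for smaller [d]. *)
Definition pinf (R : realType) (n : nat) (d : nat) (p : mpoly n R)
  (x : 'rV[R]_n) : R :=
  lim ((fun t : R => peval p (t *: x) / t ^+ d) @ +oo).

Definition vpinf (R : realType) (n q : nat) (d : 'I_q -> nat)
  (f : 'I_q -> mpoly n R) (x : 'rV[R]_n) : 'rV[R]_q :=
  \row_i pinf (d i) (f i) x.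

Definition lincomb (R : realType) (n q : nat) (l : 'rV[R]_q)
  (f : 'I_q -> mpoly n R) : mpoly n R :=
  \sum_i l 0 i *: f i.

Definition sublevel (R : realType) (n q : nat) (K : set 'rV[R]_n)
  (f : 'I_q -> mpoly n R) (xb : 'rV[R]_n) : set 'rV[R]_n :=
  [set x | K x /\ vle (vpeval f x) (vpeval f xb)].

Definition asym_cone (R : realType) (n : nat) (S : set 'rV[R]_n) :
  set 'rV[R]_n :=
  [set v | exists (t : nat -> R) (x : nat -> 'rV[R]_n),
     [/\ t @ \oo --> +oo, forall k, S (x k) &
         (fun k => (t k)^-1 *: x k) @ \oo --> v]].

Definition SOL (R : realType) (n : nat) (A : set 'rV[R]_n)
  (p : 'rV[R]_n -> R) : set 'rV[R]_n :=
  [set xs | A xs /\ forall x, A x -> p xs <= p x].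

Definition SOLs (R : realType) (n q : nat) (A : set 'rV[R]_n)
  (g : 'rV[R]_n -> 'rV[R]_q) : set 'rV[R]_n :=
  [set xs | A xs /\ forall x, A x ->
     ~ ((-%R @` @orthant R q) `\ 0) (g x - g xs)].

Definition SOLw (R : realType) (n q : nat) (A : set 'rV[R]_n)
  (g : 'rV[R]_n -> 'rV[R]_q) : set 'rV[R]_n :=
  [set xs | A xs /\ forall x, A x ->
     ~ (-%R @` interior (@orthant R q)) (g x - g xs)].

(* Main.v *)
Require Import Defs.
From HB Require Import structures.
From mathcomp Require Import all_boot all_order all_algebra.
From mathcomp Require Import all_classical all_reals all_analysis.
From mathcomp Require Import -(notations) mpoly.
Import Order.TTheory GRing.Theory Num.Theory.
Import numFieldNormedType.Exports.
Local Open Scope classical_set_scope.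
Local Open Scope ring_scope.

Set Implicit Arguments.
Unset Strict Implicit.
Unset Printing Implicit Defensive.

(** Along a sequence x_k = t_k y_k with t_k -> +oo and y_k -> v, a polynomial
    p of degree at most d satisfies p(x_k) / t_k^d -> p_d(v), where p_d is the
    homogeneous part of degree d (cvg_peval_scale). Hence the recession
    polynomial [pinf d p] is p_d, and if p is bounded above on A, then
    p_d(v) <= p_d(0) for every v in A_oo (pinf_asym_cone_le).

    Existence. Every v in the asymptotic cone of the sublevel set of f at xb
    is therefore at least as good as 0 for f^oo, and, the weights l being
    nonnegative, for the recession polynomial of the weighted sum. In each of
    the cases (i), (ii), (iii) the origin is a solution on S_oo, and a point of
    S_oo at least as good as a solution is again a solution; so v is a solution
    and v = 0. An unbounded set has a nonzero asymptotic direction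
    (unbounded_asym_cone), so the sublevel set is bounded, hence compact. A
    minimizer of f_1 + ... + f_q on it is Pareto efficient on all of K.

    Boundedness. A Pareto efficient x satisfies f_i(x) <= f_i(xb) for some i,
    since otherwise xb would beat it in every component. If SOLs K f were
    unbounded, then so would be, for some i, its part where
    f_i(x) <= f_i(xb); this gives v <> 0 in K_oo with (f_i)^oo(v) <= 0, so v
    lies in S_oo. By (iii), v is not weakly efficient: some u in S_oo beats it
    strictly in every component. The existence argument applies to the closed
    cone S_oo and to the homogeneous polynomials f^oo, at the point u, because
    S_oo is its own asymptotic cone and f^oo its own recession map. It yields a
    weakly efficient w with f^oo(w) <= f^oo(u). By (iii) again w = 0, so
    0 = (f_i)^oo(w) <= (f_i)^oo(u) < (f_i)^oo(v) <= 0, a contradiction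
    (SOLw_eq0_pinf_le0). *)

(** * Leading behaviour of polynomials *)

Lemma cvg_exprn (R : realType) (T : Type) (F : set_system T)
    {FF : Filter F} (u : T -> R) (a : R) (k : nat) :
  u @ F --> a -> (fun s => u s ^+ k) @ F --> a ^+ k.
Proof. exact: (continuous_cvg FF (@exprn_continuous R k a)). Qed.

(** After division by t ^+ d, a polynomial of degree at most d in t *: y has
    no positive power of t left: it is a polynomial in t^-1 and y, and so it
    has a limit as t tends to infinity and y converges. *)
Lemma peval_scale (R : realType) (n d : nat) (p : mpoly n R) (t : R)
    (y : 'rV[R]_n) :
  (msize p <= d.+1)%N -> t != 0 ->
  peval p (t *: y) / t ^+ d =
  \sum_(m <- msupp p)
     mcoeff m p * (t^-1 ^+ (d - mdeg m) * \prod_j y 0 j ^+ m j).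
Proof.
move=> pd t0; rewrite /peval mevalE mulr_suml !big_seq; apply: eq_bigr => m mp.
have md : (mdeg m <= d)%N by rewrite -ltnS (leq_trans (msize_mdeg_lt mp)).
rewrite -mulrA; congr (_ * _).
have -> : \prod_j (t *: y) 0 j ^+ m j = t ^+ mdeg m * \prod_j y 0 j ^+ m j.
  rewrite mdegE -prodrXr -big_split /=; apply: eq_bigr => j _.
  by rewrite mxE exprMn.
have -> : t ^+ d = t ^+ mdeg m * t ^+ (d - mdeg m) by rewrite -exprD subnKC.
by rewrite mulrAC invfM mulrA mulfV ?expf_neq0 // mul1r exprVn.
Qed.

(** The value at t^-1 = 0 of the expression in [peval_scale], as 0 ^+ k is 1
    for k = 0 and 0 otherwise. *)
Lemma peval_pihomog (R : realType) (n d : nat) (p : mpoly n R)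
    (v : 'rV[R]_n) :
  (msize p <= d.+1)%N ->
  peval (pihomog mdeg d p) v =
  \sum_(m <- msupp p)
     mcoeff m p * (0 ^+ (d - mdeg m) * \prod_j v 0 j ^+ m j).
Proof.
move=> pd; rewrite /peval pihomogE raddf_sum big_mkcond /= !big_seq.
apply: eq_bigr => m mp.
have md : (mdeg m <= d)%N by rewrite -ltnS (leq_trans (msize_mdeg_lt mp)).
rewrite expr0n subn_eq0 eqn_leq md /=.
by case: leqP => _; rewrite ?mul0r ?mulr0 // mul1r mevalZ mevalX.
Qed.

(** Stated for an arbitrary filter in order to serve both the limit along real
    t that defines [pinf] and the sequences that define [asym_cone]. *)
Lemma cvg_peval_scale (R : realType) (n d : nat) (p : mpoly n R) (T : Type)
    (F : set_system T) {FF : Filter F} (t : T -> R) (y : T -> 'rV[R]_n)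
    (v : 'rV[R]_n) :
  (msize p <= d.+1)%N -> t @ F --> +oo -> y @ F --> v ->
  (fun s => peval p (t s *: y s) / t s ^+ d) @ F -->
    peval (pihomog mdeg d p) v.
Proof.
move=> pd too yv.
have tpos : \forall s \near F, 0 < t s by move/cvgryPgt: too; exact.
have tV : (fun s => (t s)^-1) @ F --> (0 : R) by exact: (gtr0_cvgV0 tpos).2 too.
rewrite peval_pihomog //.
apply: cvg_trans; last first.
  apply: (@cvg_big _ _ _ _ xpredT add_continuous _ F (msupp p)
    (fun m s => mcoeff m p * ((t s)^-1 ^+ (d - mdeg m) *
       \prod_j y s 0 j ^+ m j))) => m _.
  apply: cvgMl_tmp; apply: cvgM; first exact: cvg_exprn.
  apply: cvg_big => [|j _]; first exact: mul_continuous.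
  apply: cvg_exprn.
  exact: (continuous_cvg FF (@coord_continuous R 1 n 0 j v) yv).
apply: near_eq_cvg; near=> s.
rewrite peval_scale // gt_eqF //.
by near: s.
Unshelve. all: by end_near.
Qed.

Lemma pinfE (R : realType) (n d : nat) (p : mpoly n R) :
  (msize p <= d.+1)%N -> pinf d p = peval (pihomog mdeg d p).
Proof.
move=> pd; apply/funext => v; apply: cvg_lim => //.
exact: (cvg_peval_scale pd cvg_id (cvg_cst v)).
Qed.

Lemma peval_continuous (R : realType) (n : nat) (p : mpoly n R) :
  continuous (peval p).
Proof.
move=> v; have -> : peval p = fun y =>
    \sum_(m <- msupp p) mcoeff m p * \prod_j y 0 j ^+ m j.
  by apply/funext => y; rewrite /peval mevalE.
apply: (@cvg_big _ _ _ _ xpredT _ _ (nbhs v)) => [|m _].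
  exact: add_continuous.
apply: cvgMl_tmp.
apply: (@cvg_big _ _ _ _ xpredT _ _ (nbhs v)) => [|j _].
  exact: mul_continuous.
apply: (@cvg_comp _ _ _ (fun s : 'rV[R]_n => s 0 j) (fun x => x ^+ m j)).
  exact: coord_continuous.
exact: exprn_continuous.
Qed.

Lemma cvg_divr_exp (R : realType) (d : nat) (c : R) (T : Type)
    (F : set_system T) {FF : Filter F} (t : T -> R) :
  (0 < d)%N -> t @ F --> +oo ->
  (fun s => c / t s ^+ d) @ F --> (0 : R).
Proof.
move=> d0 too.
have tpos : \forall s \near F, 0 < t s by move/cvgryPgt: too; exact.
have tV : (fun s => (t s)^-1) @ F --> (0 : R) by exact: (gtr0_cvgV0 tpos).2 too.
have -> : (fun s => c / t s ^+ d) = (fun s => c * (t s)^-1 ^+ d).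
  by apply/funext => s; rewrite exprVn.
rewrite -[0](mulr0 c) -[X in c * X](_ : 0 ^+ d = 0); last first.
  by rewrite expr0n gtn_eqF.
by apply: cvgMl_tmp; exact: cvg_exprn.
Qed.

Lemma pinf0 (R : realType) (n d : nat) (p : mpoly n R) :
  (0 < d)%N -> pinf d p 0 = 0.
Proof.
move=> d0; apply: cvg_lim => //.
under eq_fun do rewrite scaler0.
exact: (cvg_divr_exp _ d0 cvg_id).
Qed.

(** * Asymptotic cones *)

Lemma asym_coneS (R : realType) (n : nat) (A B : set 'rV[R]_n) :
  A `<=` B -> asym_cone A `<=` asym_cone B.
Proof.
by move=> AB v [t [x [too Ax xv]]]; exists t, x; split=> // k; exact: AB.
Qed.

(** The sequence-free form of membership, in which diagonal arguments reduce to
    a choice of epsilon; one e measures both how large t is and how close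
    x / t is to v. *)
Lemma asym_coneP (R : realType) (n : nat) (S : set 'rV[R]_n) (v : 'rV[R]_n) :
  asym_cone S v <->
  forall e : R, 0 < e ->
    exists t x, [/\ e^-1 < t, S x & `|v - t^-1 *: x| < e].
Proof.
split=> [[t [x [too Sx xv]]] e e0|H].
  near \oo => k; exists (t k), (x k); split=> //; near: k.
    by move/cvgryPgt: too; exact.
  by move/cvgrPdist_lt: xv; exact.
have Hk k : exists tx : R * 'rV[R]_n,
    [/\ k.+1%:R < tx.1, S tx.2 & `|v - tx.1^-1 *: tx.2| < k.+1%:R^-1].
  have [|t [x [h1 h2 h3]]] := H k.+1%:R^-1; first by rewrite invr_gt0.
  by exists (t, x); split=> //=; rewrite -[k.+1%:R]invrK.
have [tx Htx] := choice Hk.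
exists (fun k => (tx k).1), (fun k => (tx k).2); split.
- apply/cvgryPgt => A; near=> k; have [h _ _] := Htx k.
  apply: lt_trans h; apply: (@lt_trans _ _ k%:R); last by rewrite ltr_nat.
  by near: k; exact: nbhs_infty_gtr.
- by move=> k; have [] := Htx k.
- apply/cvgrPdist_lt => e e0; near=> k; have [_ _ h] := Htx k.
  apply: (lt_trans h); near: k.
  exact: (near_infty_natSinv_lt (PosNum e0)).
Unshelve. all: by end_near.
Qed.

Lemma asym_cone_closed (R : realType) (n : nat) (S : set 'rV[R]_n) :
  closed (asym_cone S).
Proof.
move=> v clv; apply/asym_coneP => e e0.
have e20 : 0 < e / 2 by rewrite divr_gt0.
have [w [Sw]] := clv _ (nbhsx_ballx v _ e20).
rewrite -ball_normE /= => vw.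
have [t [x [te Sx wx]]] := (asym_coneP S w).1 Sw _ e20.
exists t, x; split=> //.
  rewrite (le_lt_trans _ te) // lef_pV2 ?posrE // ler_pdivrMr //.
  by rewrite ler_peMr ?ler1n // ltW.
by rewrite (splitr e) (le_lt_trans (ler_distD w _ _)) // ltrD.
Qed.

(** If v is close to w / s and w is close to x / t, then v is close to
    x / (s t) as soon as s >= 1. *)
Lemma asym_cone_idem (R : realType) (n : nat) (S : set 'rV[R]_n) :
  asym_cone (asym_cone S) `<=` asym_cone S.
Proof.
move=> v /asym_coneP Cv; apply/asym_coneP => e e0.
have e20 : 0 < e / 2 by rewrite divr_gt0.
(* The bound 1 forces s > 1, so that dividing by s does not increase errors. *)
pose e' := Num.min (e / 2) 1.
have e'0 : 0 < e' by rewrite lt_min e20 ltr01.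
have [s [w [se Sw vw]]] := Cv _ e'0.
have [t [x [te Sx wx]]] := (asym_coneP S w).1 Sw _ e20.
have s1 : 1 < s by apply: le_lt_trans se; rewrite invf_ge1 // ge_min lexx orbT.
have s0 : 0 < s by rewrite (lt_trans ltr01).
have te' : e^-1 < t.
  rewrite (le_lt_trans _ te) // lef_pV2 ?posrE // ler_pdivrMr //.
  by rewrite ler_peMr ?ler1n // ltW.
have t0 : 0 < t by rewrite (lt_trans _ te') ?invr_gt0.
exists (s * t), x; split=> //.
  by rewrite (lt_trans te') // ltr_pMl.
rewrite (splitr e) (le_lt_trans (ler_distD (s^-1 *: w) _ _)) // ltrD //.
  by rewrite (lt_le_trans vw) // ge_min lexx.
rewrite invfM -scalerA -scalerBr normrZ gtr0_norm ?invr_gt0 //.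
by apply: le_lt_trans wx; rewrite ler_piMl // invf_le1 // ltW.
Qed.

(** Normalize points of A that tend to infinity: by compactness of the unit
    sphere their directions have a cluster point, of norm 1. *)
Lemma unbounded_asym_cone (R : realType) (n : nat) (A : set 'rV[R]_n) :
  ~ bounded_set A -> exists2 v, asym_cone A v & v != 0.
Proof.
move=> Aub.
have Ak (k : nat) : exists x, A x /\ k.+1%:R < `|x|.
  apply: contrapT => Hk; apply: Aub; exists k.+1%:R.
  split; first exact: num_real.
  move=> M kM x Ax /=; apply: le_trans (ltW kM); rewrite leNgt.
  by apply/negP => h; apply: Hk; exists x.
have [x Hx] := choice Ak.
have x0 k : 0 < `|x k| by apply: lt_trans (Hx k).2.
pose y k := `|x k|^-1 *: x k.
pose B := [set z : 'rV[R]_n | `|z| = 1].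
have By k : B (y k).
  by rewrite /B /= normrZ ger0_norm ?invr_ge0 // mulVf // gt_eqF.
have cB : compact B.
  apply: bounded_closed_compact.
    exists 1; split; first exact: num_real.
    by move=> M M1 z /= ->; exact: ltW.
  have -> : B = (fun z : 'rV[R]_n => `|z|) @^-1` [set 1] by [].
  apply: preimage_closed; last exact: closed_eq.
  by move=> z _; exact: norm_continuous.
have yB : (y @ \oo) B by apply: (@filterE _ \oo) => k; exact: By.
have [v [Bv clv]] := cB _ _ yB; exists v; last by rewrite -normr_gt0 Bv.
apply/asym_coneP => e e0.
have yE : (y @ \oo) [set y k | k in [set k : nat | e^-1 < k%:R]].
  have := nbhs_infty_gtr e^-1.
  by apply: (@filterS _ \oo) => k ek; exists k.
have [_ [[k /= ek <-]]] := clv _ _ yE (nbhsx_ballx v _ e0).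
rewrite -ball_normE /= => vy.
exists `|x k|, (x k); split=> //; last by have [] := Hx k.
by apply: lt_trans ek _; apply: lt_trans (Hx k).2; rewrite ltr_nat.
Qed.

(** Divide p(x_k) <= c by t_k^d and pass to the limit. The right-hand side is
    [pinf d p 0] and not 0, which makes the inequality true for d = 0 as well:
    then p is constant. This case occurs for the weighted sum in (i), where the
    terms of positive degree may cancel. *)
Lemma pinf_asym_cone_le (R : realType) (n d : nat) (p : mpoly n R)
    (A : set 'rV[R]_n) (c : R) (v : 'rV[R]_n) :
  (msize p <= d.+1)%N -> (forall x, A x -> peval p x <= c) ->
  asym_cone A v -> pinf d p v <= pinf d p 0.
Proof.
case: d => [|d] pd pc [t [x [too Ax xv]]].
  have pC z : peval p z = mcoeff mnm0 p.
    by rewrite /peval (msize1_polyC pd) mevalC mcoeffC eqxx mulr1.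
  rewrite /pinf.
  suff -> : (fun s => peval p (s *: v) / s ^+ 0) =
            (fun s => peval p (s *: 0) / s ^+ 0) by [].
  by apply/funext => s; rewrite !pC.
rewrite pinf0 // pinfE //.
have tpos : \forall k \near \oo, 0 < t k by move/cvgryPgt: too; exact.
apply: (ler_cvg_to (cvg_peval_scale pd too xv) (cvg_divr_exp c (ltn0Sn d) too)).
near=> k; have tk : 0 < t k by near: k.
rewrite scalerA mulfV ?gt_eqF // scale1r ler_pM2r ?invr_gt0 ?exprn_gt0 //.
exact: pc.
Unshelve. all: by end_near.
Qed.

(** * Pareto order and solution sets *)

Lemma vleE (R : realType) (q : nat) (y z : 'rV[R]_q) :
  vle y z <-> forall i, y 0 i <= z 0 i.
Proof.
by split=> h i; move: (h i); rewrite !mxE subr_ge0.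
Qed.

Lemma in_neg_orthant (R : realType) (q : nat) (y z : 'rV[R]_q) :
  ((-%R @` @orthant R q) `\ 0) (y - z) <-> vle y z /\ y <> z.
Proof.
split=> [[[w w0 wE] /= yz]|[yz nyz]].
  split; last by move=> yzE; apply: yz; rewrite yzE subrr.
  by rewrite /vle -opprB -wE opprK.
split; first by exists (z - y) => //; rewrite opprB.
by move=> /subr0_eq.
Qed.

Lemma interior_orthantE (R : realType) (q : nat) :
  interior (@orthant R q) = [set y | forall i, 0 < y 0 i].
Proof.
apply/seteqP; split=> y /=.
  move=> /nbhs_ballP[e /= e0 ye] i.
  have /ye : ball y e (y - const_mx (e / 2)).
    split=> // a j; rewrite -ball_normE /= !mxE opprB addrC subrK.
    rewrite gtr0_norm ?divr_gt0 //.
    by rewrite gtr_pMr // invf_lt1 // ltr1n.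
  move=> /(_ i); rewrite !mxE subr_ge0; apply: lt_le_trans.
  by rewrite divr_gt0.
move=> y0; have yi (i : 'I_q) : nbhs y [set z : 'rV[R]_q | 0 <= z 0 i].
  apply: (@coord_continuous R 1 q 0 i y [set r | 0 <= r]).
  by apply: (filterS (fun r => @ltW _ _ 0 r)); exact: lt_nbhsr.
by have := filter_forall _ yi; apply.
Qed.

Lemma in_neg_int_orthant (R : realType) (q : nat) (y z : 'rV[R]_q) :
  (-%R @` interior (@orthant R q)) (y - z) <-> forall i, y 0 i < z 0 i.
Proof.
rewrite interior_orthantE; split=> [[w w0 wE] i|yz].
  by rewrite -subr_gt0; have := w0 i; rewrite -[w]opprK wE !mxE opprB.
by exists (z - y); rewrite ?opprB // => i; rewrite !mxE subr_gt0.
Qed.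

Lemma SOLs_sub_SOLw (R : realType) (n q : nat) (A : set 'rV[R]_n)
    (g : 'rV[R]_n -> 'rV[R]_q) :
  (0 < q)%N -> SOLs A g `<=` SOLw A g.
Proof.
move=> q0 x [Ax xs]; split=> // y Ay /in_neg_int_orthant yx.
apply: (xs y Ay); apply/in_neg_orthant; split.
  by apply/vleE => i; exact: ltW.
by move=> E; have := yx (Ordinal q0); rewrite E ltxx.
Qed.

Lemma SOL_le (R : realType) (n : nat) (A : set 'rV[R]_n) (p : 'rV[R]_n -> R)
    (x v : 'rV[R]_n) :
  SOL A p x -> A v -> p v <= p x -> SOL A p v.
Proof. by move=> [Ax xp] Av vx; split=> // y /xp; exact: le_trans. Qed.

(** A point that is at least as good as an efficient one has the same value. *)
Lemma SOLs_le (R : realType) (n q : nat) (A : set 'rV[R]_n)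
    (g : 'rV[R]_n -> 'rV[R]_q) (x v : 'rV[R]_n) :
  SOLs A g x -> A v -> vle (g v) (g x) -> SOLs A g v.
Proof.
move=> [Ax xs] Av vx.
have vxE : g v = g x.
  by apply: contrapT => ne; apply: (xs v Av); apply/in_neg_orthant.
by split=> // y Ay; rewrite vxE; exact: xs.
Qed.

Lemma SOLw_le (R : realType) (n q : nat) (A : set 'rV[R]_n)
    (g : 'rV[R]_n -> 'rV[R]_q) (x v : 'rV[R]_n) :
  SOLw A g x -> A v -> vle (g v) (g x) -> SOLw A g v.
Proof.
move=> [Ax xs] Av /vleE vx; split=> // y Ay /in_neg_int_orthant yv.
by apply: (xs y Ay); apply/in_neg_int_orthant => i; exact: lt_le_trans (vx i).
Qed.

(** * Existence of efficient points in bounded sublevel sets *)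

Lemma sublevelP (R : realType) (n q : nat) (K : set 'rV[R]_n)
    (f : 'I_q -> mpoly n R) (u x : 'rV[R]_n) :
  sublevel K f u x <-> K x /\ forall i, peval (f i) x <= peval (f i) u.
Proof.
split=> -[Kx]; rewrite ?vleE => xu; split=> //.
  by move=> i; have := xu i; rewrite !mxE.
by apply/vleE => i; rewrite !mxE.
Qed.

Lemma peval_lincomb (R : realType) (n q : nat) (l : 'rV[R]_q)
    (f : 'I_q -> mpoly n R) (x : 'rV[R]_n) :
  peval (lincomb l f) x = \sum_i l 0 i * peval (f i) x.
Proof.
by rewrite /peval raddf_sum /=; apply: eq_bigr => i _; rewrite mevalZ.
Qed.

Lemma closed_sublevel (R : realType) (n q : nat) (K : set 'rV[R]_n)
    (f : 'I_q -> mpoly n R) (u : 'rV[R]_n) :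
  closed K -> closed (sublevel K f u).
Proof.
move=> Kc; have -> : sublevel K f u = K `&`
    \bigcap_(i in [set: 'I_q]) (peval (f i) @^-1` [set r | r <= peval (f i) u]).
  apply/seteqP; split=> x.
    by move=> /sublevelP[Kx xu]; split=> // i _; exact: xu.
  by move=> [Kx xu]; apply/sublevelP; split=> // i; exact: xu.
apply: closedI => //; apply: closed_bigI => i _.
apply: preimage_closed; last exact: closed_le.
by move=> x _; exact: peval_continuous.
Qed.

(** A minimizer w of the sum of the f_i on the sublevel set is efficient on K:
    any x with f(x) <= f(w) stays in the sublevel set, and the sum does not
    decrease, so all components agree. *)
Lemma SOLs_sublevel_ex (R : realType) (n q : nat) (K : set 'rV[R]_n)
    (f : 'I_q -> mpoly n R) (u : 'rV[R]_n) :
  closed K -> K u -> bounded_set (sublevel K f u) ->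
  exists2 w, SOLs K (vpeval f) w & forall i, peval (f i) w <= peval (f i) u.
Proof.
move=> Kc Ku bs.
have cs := bounded_closed_compact bs (closed_sublevel Kc).
have s0 : sublevel K f u !=set0 by exists u; apply/sublevelP.
pose p := lincomb (const_mx 1) f.
have [|w ws wmin] := EVT_min_rV (f := peval p) s0 cs.
  by apply: continuous_subspaceT; exact: peval_continuous.
move: ws; rewrite inE => /sublevelP[Kw wu]; exists w => //; split=> // x Kx.
move=> /in_neg_orthant[/vleE xw]; apply; apply/rowP => i.
have {}xw j : peval (f j) x <= peval (f j) w by have := xw j; rewrite !mxE.
rewrite !mxE.
have xs : x \in sublevel K f u.
  by rewrite inE; apply/sublevelP; split=> // j; exact: le_trans (wu j).
have pE y : peval p y = \sum_j peval (f j) y.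
  by rewrite peval_lincomb; apply: eq_bigr => j _; rewrite mxE mul1r.
have := wmin _ xs; rewrite !pE => le_wx.
have /eqP : \sum_j (peval (f j) w - peval (f j) x) = 0.
  apply/eqP; rewrite eq_le sumr_ge0 ?andbT => [|j _]; last by rewrite subr_ge0.
  by rewrite sumrB subr_le0.
rewrite psumr_eq0 => [|j _]; last by rewrite subr_ge0.
by move=> /allP/(_ i); rewrite mem_index_enum subr_eq0 => /(_ isT)/eqP.
Qed.

Lemma sublevel_bounded (R : realType) (n q : nat) (K : set 'rV[R]_n)
    (f : 'I_q -> mpoly n R) (u : 'rV[R]_n) :
  (forall v, asym_cone (sublevel K f u) v -> v = 0) ->
  bounded_set (sublevel K f u).
Proof.
move=> v0; apply: contrapT => /unbounded_asym_cone[v /v0 ->].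
by rewrite eqxx.
Qed.

Lemma msize_pdeg (R : realType) (n : nat) (p : mpoly n R) :
  (msize p <= (pdeg p).+1)%N.
Proof. by rewrite /pdeg; exact: leqSpred. Qed.

(** * Efficient points under conditions on the asymptotic cone *)

Lemma vpinf_sublevel (R : realType) (n q : nat) (K : set 'rV[R]_n)
    (f : 'I_q -> mpoly n R) (d : 'I_q -> nat) (u v : 'rV[R]_n) :
  (forall i, (msize (f i) <= (d i).+1)%N) ->
  asym_cone (sublevel K f u) v -> vle (vpinf d f v) (vpinf d f 0).
Proof.
move=> fd cv; apply/vleE => i; rewrite !mxE.
apply: (pinf_asym_cone_le (fd i) _ cv) => x /sublevelP[_]; exact.
Qed.

Lemma pinf_lincomb_sublevel (R : realType) (n q : nat) (K : set 'rV[R]_n)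
    (f : 'I_q -> mpoly n R) (l : 'rV[R]_q) (u v : 'rV[R]_n) :
  orthant l -> asym_cone (sublevel K f u) v ->
  pinf (pdeg (lincomb l f)) (lincomb l f) v <=
  pinf (pdeg (lincomb l f)) (lincomb l f) 0.
Proof.
move=> l0 cv.
apply: (pinf_asym_cone_le (c := peval (lincomb l f) u) (msize_pdeg _) _ cv).
move=> x /sublevelP[_ xu]; rewrite !peval_lincomb; apply: ler_sum => i _.
by rewrite ler_wpM2l.
Qed.

(** Asymptotic directions of the sublevel set are at least as good as 0 for the
    recession problem, whose only solution is 0; so the sublevel set has no
    nonzero asymptotic direction. *)
Lemma SOLs_nonempty (R : realType) (n q : nat) (K : set 'rV[R]_n)
    (f : 'I_q -> mpoly n R) (d : 'I_q -> nat) (u : 'rV[R]_n)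
    (l : 'rV[R]_q) (C : set 'rV[R]_n) :
  closed K -> (forall i, (msize (f i) <= (d i).+1)%N) -> K u -> orthant l ->
  asym_cone (sublevel K f u) `<=` C ->
  [\/ SOL C (pinf (pdeg (lincomb l f)) (lincomb l f)) = [set 0],
      SOLs C (vpinf d f) = [set 0] |
      SOLw C (vpinf d f) = [set 0]] ->
  SOLs K (vpeval f) !=set0.
Proof.
move=> Kc fd Ku l0 sC H.
suff sb : bounded_set (sublevel K f u).
  by have [w ws _] := SOLs_sublevel_ex Kc Ku sb; exists w.
apply: sublevel_bounded => v cv; have Cv := sC _ cv.
have vle0 := vpinf_sublevel fd cv.
case: H => E; suff : [set 0 : 'rV[R]_n] v by []; rewrite -E.
- by apply: (@SOL_le _ _ _ _ 0) (pinf_lincomb_sublevel l0 cv) => //; rewrite E.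
- by apply: (@SOLs_le _ _ _ _ _ 0) vle0 => //; rewrite E.
- by apply: (@SOLw_le _ _ _ _ _ 0) vle0 => //; rewrite E.
Qed.

Lemma msize_pihomog (R : realType) (n d : nat) (p : mpoly n R) :
  (msize (pihomog mdeg d p) <= d.+1)%N.
Proof.
rewrite pihomogE (leq_trans (msize_sum _ _ _)) //.
apply/bigmax_leqP_seq => m _ /eqP <-.
by rewrite (leq_trans (msizeZ_le _ _)) // msizeX.
Qed.

Lemma vpinf_vpeval (R : realType) (n q : nat) (f : 'I_q -> mpoly n R)
    (d : 'I_q -> nat) :
  (forall i, (msize (f i) <= (d i).+1)%N) ->
  vpinf d f = vpeval (fun i => pihomog mdeg (d i) (f i)).
Proof.
by move=> fd; apply/funext => x; apply/rowP => i; rewrite !mxE pinfE.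
Qed.

(** Were v not 0, it would not be weakly efficient, so some u in C beats it
    strictly in every component. The points of C at least as good as u form a
    set with no nonzero asymptotic direction, as such a direction would lie in
    C and be at least as good as 0. By compactness there is an efficient w at
    least as good as u; then w = 0, although (f_i)^oo(w) < 0. *)
Lemma SOLw_eq0_pinf_le0 (R : realType) (n q : nat) (C : set 'rV[R]_n)
    (f : 'I_q -> mpoly n R) (d : 'I_q -> nat) (v : 'rV[R]_n) (i : 'I_q) :
  (forall i, (msize (f i) <= (d i).+1)%N) -> (0 < d i)%N ->
  closed C -> asym_cone C `<=` C -> SOLw C (vpinf d f) = [set 0] ->
  C v -> pinf (d i) (f i) v <= 0 -> v = 0.
Proof.
move=> fd di Cc CC E Cv vi.
suff : [set 0 : 'rV[R]_n] v by [].
rewrite -E; split=> // u Cu /in_neg_int_orthant uv.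
(* [pihomog] is idempotent: the f^oo are polynomials equal to their own
   recession polynomials, so the results on [sublevel] apply to them. *)
pose h := fun i => pihomog mdeg (d i) (f i).
have hf : vpinf d f = vpeval h by exact: vpinf_vpeval.
have hh : vpinf d h = vpeval h.
  rewrite vpinf_vpeval; last by move=> j; exact: msize_pihomog.
  by congr vpeval; apply/funext => j; rewrite /h pihomog_id.
have [w ws wu] : exists2 w, SOLs C (vpeval h) w &
    forall j, peval (h j) w <= peval (h j) u.
  apply: SOLs_sublevel_ex => //; apply: sublevel_bounded => x cx.
  suff : [set 0 : 'rV[R]_n] x by []; rewrite -E hf.
  apply: (@SOLw_le _ _ _ _ _ 0).
  - by rewrite -hf E.
  - by apply: CC; apply: asym_coneS cx => y [].
  - by rewrite -hh; apply: vpinf_sublevel cx => j; exact: msize_pihomog.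
have w0 : w = 0.
  have : SOLw C (vpinf d f) w.
    rewrite hf; apply: SOLs_sub_SOLw ws; exact: leq_ltn_trans (ltn_ord i).
  by rewrite E.
have := uv i; rewrite !mxE => ui.
have := wu i; rewrite /h -!pinfE // w0 pinf0 // leNgt => /negP; apply.
exact: lt_le_trans vi.
Qed.

(** The efficient set is covered by the finitely many sets A i, each of which
    has no nonzero asymptotic direction. *)
Lemma SOLs_bounded (R : realType) (n q : nat) (K : set 'rV[R]_n)
    (f : 'I_q -> mpoly n R) (d : 'I_q -> nat) (u : 'rV[R]_n)
    (C : set 'rV[R]_n) :
  (0 < q)%N -> K u ->
  (forall i, (msize (f i) <= (d i).+1)%N) -> (forall i, (0 < d i)%N) ->
  closed C -> asym_cone C `<=` C -> SOLw C (vpinf d f) = [set 0] ->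
  asym_cone K `&` \bigcup_i [set x | pinf (d i) (f i) x <= 0] `<=` C ->
  bounded_set (SOLs K (vpeval f)).
Proof.
move=> q0 Ku fd d0 Cc CC E KC.
pose A i := [set x | SOLs K (vpeval f) x /\ peval (f i) x <= peval (f i) u].
have Ab i : bounded_set (A i).
  apply: contrapT => /unbounded_asym_cone[v Av /eqP]; apply.
  have vi : pinf (d i) (f i) v <= 0.
    rewrite -(pinf0 (f i) (d0 i)).
    by apply: (pinf_asym_cone_le (c := peval (f i) u) (fd i) _ Av) => x [].
  apply: (SOLw_eq0_pinf_le0 fd (d0 i) Cc CC E _ vi).
  apply: KC; split; last by exists i.
  by apply: asym_coneS Av => x [[]].
have AE : SOLs K (vpeval f) `<=` \bigcup_i A i.
  move=> x xs; apply: contrapT => nA.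
  have ux i : peval (f i) u < peval (f i) x.
    by rewrite ltNge; apply/negP => h; apply: nA; exists i.
  have [_ /(_ u Ku)] := SOLs_sub_SOLw q0 xs; apply.
  by apply/in_neg_int_orthant => i; rewrite !mxE.
have : \forall M \near +oo, forall i : 'I_q, globally (A i) [set x | `|x| <= M].
  exact: filter_forall.
apply: filterS => M HM x /AE[i _ Aix]; exact: HM Aix.
Qed.

Theorem theorem11 (R : realType) (n q : nat) (K : set 'rV[R]_n)
    (f : 'I_q -> mpoly n R) (d : 'I_q -> nat)
    (xb : 'rV[R]_n) (l : 'rV[R]_q) :
  K !=set0 -> ~ bounded_set K -> closed K ->
  (forall i, pdeg (f i) = d i) -> (forall i, (1 <= d i)%N) ->
  K xb -> orthant l -> l != 0 ->
  ((exists S : set 'rV[R]_n,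
      [/\ closed S,
          asym_cone (sublevel K f xb) `<=` asym_cone S,
          asym_cone S `<=` asym_cone K &
          [\/ SOL (asym_cone S) (pinf (pdeg (lincomb l f)) (lincomb l f))
                = [set 0],
              SOLs (asym_cone S) (vpinf d f) = [set 0] |
              SOLw (asym_cone S) (vpinf d f) = [set 0]]]) ->
   SOLs K (vpeval f) !=set0) /\
  ((exists S : set 'rV[R]_n,
      [/\ asym_cone K `&` \bigcup_i [set x | pinf (d i) (f i) x <= 0]
            `<=` asym_cone S,
          asym_cone S `<=` asym_cone K &
          SOLw (asym_cone S) (vpinf d f) = [set 0]]) ->
   SOLs K (vpeval f) !=set0 /\ bounded_set (SOLs K (vpeval f))).
Proof.
move=> _ _ Kc df d1 Kxb l0 lN0.
have q0 : (0 < q)%N.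
  rewrite lt0n; apply/eqP => q0; move/eqP: lN0; apply; apply/rowP => -[i iq].
  by exfalso; move: iq; rewrite q0.
have fd i : (msize (f i) <= (d i).+1)%N by rewrite -df; exact: msize_pdeg.
split=> [[S [_ KS _ H]]|[S [KS _ H]]].
  exact: (SOLs_nonempty Kc fd Kxb l0 KS H).
split; last exact: (SOLs_bounded q0 Kxb fd d1 (@asym_cone_closed _ _ S)
                      (@asym_cone_idem _ _ S) H KS).
have sS : asym_cone (sublevel K f xb) `<=` asym_cone S.
  move=> v cv; apply: KS; split.
    by apply: asym_coneS cv => x [].
  exists (Ordinal q0) => //=.
  have /vleE/(_ (Ordinal q0)) := vpinf_sublevel fd cv.
  by rewrite !mxE pinf0.
exact: (SOLs_nonempty Kc fd Kxb l0 sS (Or33 _ _ H)).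
Qed.
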